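(* Let $R$ be a unitary ring with an involution $*$, let $a \in R$, and let $m,n \in R$ be two invertible and positive elements. The following statements are equivalent: (i) $a$ is weighted Moore-Penrose invertible relative to $m$ and $n$; (ii) $a$ is invertible along $n^{-1}a^*m$. Furthermore, in this case, $a^{\parallel n^{-1}a^*m} = a^\dag_{m,n}$.
   Context: An involution on a ring $R$ is a map $*:R\to R$ with $(a+b)^*=a^*+b^*$, $(ab)^*=b^*a^*$, $(a^* )^*=a$ for all $a,b$. An element $x$ is Hermitian if $x^*=x$, and positive if there exists a Hermitian $y\in R$ with $x=y^2$ (positive elements are Hermitian). Inverse along an element: for $a,d\in R$, $a$ is invertible along $d$ if there exists $b\in R$ such that $bab=b$, $bR=dR$ and $Rb=Rd$. Such $b$ is unique when it exists and is denoted $a^{\parallel d}$. Weighted Moore-Penrose inverse: for invertible Hermitian $m,n\in R$, $a$ is weighted Moore-Penrose invertible relative to $m$ and $n$ if there exists $x\in R$ with $axa=a$, $xax=x$, $(max)^*=max$, $(nxa)^*=nxa$. Such $x$ is unique when it exists and is denoted $a^\dag_{m,n}$. *)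

(* Defs.v *)
From mathcomp Require Import all_boot all_algebra.

Set Implicit Arguments.
Unset Strict Implicit.
Unset Printing Implicit Defensive.

Import GRing.Theory.
Local Open Scope ring_scope.

(* The carrier is a [pzRingType], so that the zero ring is not excluded; as
   MathComp's [GRing.unit] and [_^-1] only exist on nonzero rings, two-sided
   inverses are spelled out. *)
Definition is_inverse (R : pzRingType) (x y : R) : Prop :=
  x * y = 1 /\ y * x = 1.

Definition invertible (R : pzRingType) (x : R) : Prop :=
  exists y, is_inverse x y.

Record is_involution (R : pzRingType) (star : R -> R) : Prop := IsInvolution {
  starD : forall x y, star (x + y) = star x + star y;
  starM : forall x y, star (x * y) = star y * star x;
  starK : forall x, star (star x) = x
}.

Definition hermitian (R : pzRingType) (star : R -> R) (x : R) : Prop :=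
  star x = x.

Definition positive (R : pzRingType) (star : R -> R) (x : R) : Prop :=
  exists y, hermitian star y /\ x = y ^+ 2.

(* Membership in x R and in R x, respectively. *)
Definition right_ideal (R : pzRingType) (x z : R) : Prop :=
  exists r, z = x * r.

Definition left_ideal (R : pzRingType) (x z : R) : Prop :=
  exists r, z = r * x.

(* [is_inverse_along a d b] : b is the inverse of a along d. *)
Record is_inverse_along (R : pzRingType) (a d b : R) : Prop := IsInverseAlong {
  inv_along_outer : b * a * b = b;
  inv_along_right : forall z, right_ideal b z <-> right_ideal d z;
  inv_along_left : forall z, left_ideal b z <-> left_ideal d z
}.

Definition invertible_along (R : pzRingType) (a d : R) : Prop :=
  exists b, is_inverse_along a d b.

(* [is_wMP star m n a x] : x is the Moore-Penrose inverse of a with weights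
   m and n. *)
Record is_wMP (R : pzRingType) (star : R -> R) (m n a x : R) : Prop := IsWMP {
  wMP_inner : a * x * a = a;
  wMP_outer : x * a * x = x;
  wMP_herm_left : hermitian star (m * a * x);
  wMP_herm_right : hermitian star (n * x * a)
}.

Definition wMP_invertible (R : pzRingType) (star : R -> R) (m n a : R) : Prop :=
  exists x, is_wMP star m n a x.

Lemma is_inverse_uniq (R : pzRingType) (x y y' : R) :
  is_inverse x y -> is_inverse x y' -> y = y'.
Proof.
by move=> [_ yx] [xy' _]; rewrite -[y]mulr1 -xy' mulrA yx mul1r.
Qed.

Lemma is_inverse_along_uniq (R : pzRingType) (a d b c : R) :
  is_inverse_along a d b -> is_inverse_along a d c -> b = c.
Proof.
move=> [bab bR Rb] [cac cR Rc].
have /bR /cR [r br] : right_ideal b b by exists 1; rewrite mulr1.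
have /Rc /Rb [s cs] : left_ideal c c by exists 1; rewrite mul1r.
have cab : c * a * b = b by rewrite br mulrA cac.
have cab' : c * a * b = c by rewrite cs -!mulrA [b * (a * b)]mulrA bab.
by rewrite -cab cab'.
Qed.

Lemma is_wMP_uniq (R : pzRingType) (star : R -> R) (m n a x y : R) :
  is_involution star ->
  invertible m -> hermitian star m -> invertible n -> hermitian star n ->
  is_wMP star m n a x -> is_wMP star m n a y -> x = y.
Proof.
move=> [_ sM _] [m' [mm' m'm]] hm [n' [nn' n'n]] hn.
move=> [axa xax hmx hnx] [aya yay hmy hny].
have mI u v : m * u = m * v -> u = v.
  by move=> e; rewrite -[u]mul1r -[v]mul1r -m'm -!mulrA e.
have nI u v : n * u = n * v -> u = v.
  by move=> e; rewrite -[u]mul1r -[v]mul1r -n'n -!mulrA e.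
have hmx' : star (a * x) * m = m * (a * x) by rewrite -{1}hm -sM mulrA hmx.
have hmy' : star (a * y) * m = m * (a * y) by rewrite -{1}hm -sM mulrA hmy.
have hnx' : star (x * a) * n = n * (x * a) by rewrite -{1}hn -sM mulrA hnx.
have hny' : star (y * a) * n = n * (y * a) by rewrite -{1}hn -sM mulrA hny.
have eax : a * x = a * y.
  have pq : a * x * (a * y) = a * y by rewrite mulrA axa.
  have qp : a * y * (a * x) = a * x by rewrite mulrA aya.
  by apply: mI; rewrite -[in RHS]pq [RHS]mulrA -hmx' -[RHS]mulrA -hmy' [RHS]mulrA -sM qp.
have exa : x * a = y * a.
  have pq : y * a * (x * a) = y * a by rewrite -mulrA [a * (x * a)]mulrA axa.
  have qp : x * a * (y * a) = x * a by rewrite -mulrA [a * (y * a)]mulrA aya.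
  by apply: nI; rewrite -[in RHS]pq [RHS]mulrA -hny' -[RHS]mulrA -hnx' [RHS]mulrA -sM qp.
by rewrite -xax exa -mulrA eax mulrA yay.
Qed.

(* Main.v *)
Require Import Defs.
From mathcomp Require Import all_boot all_algebra.

Import GRing.Theory.
Local Open Scope ring_scope.

(** With d = n^-1 a^* m, a weighted Moore-Penrose inverse x satisfies
    x a = n^-1 (x a)^* n and a x = m^-1 (a x)^* m, which expresses x as a left
    and a right multiple of d and conversely. If b is the inverse of a along d,
    then d a b = d = b a d; cancelling n^-1 and m gives (a b)^* m a = m a and
    (b a) n^-1 a^* = n^-1 a^*. Multiplying on the right by b, resp. b^*, makes the
    left-hand sides Hermitian, so that m (a b) and n (b a) are Hermitian, and
    then m (a b) a = m a yields a b a = a. *)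

Lemma positive_hermitian {R : pzRingType} {star : R -> R} {x : R} :
  is_involution star -> positive star x -> Defs.hermitian star x.
Proof. by move=> [_ sM _] [y [hy ->]]; rewrite /Defs.hermitian expr2 sM hy. Qed.

Lemma star1 {R : pzRingType} {star : R -> R} :
  is_involution star -> star 1 = 1.
Proof.
by move=> [_ sM sK]; rewrite -[LHS]mulr1 -[X in _ * X]sK -sM mulr1 sK.
Qed.

(** Applying [star] to both inverse equations makes [star y] another inverse of [x], so uniqueness
    applies. *)
Lemma hermitian_inverse {R : pzRingType} {star : R -> R} {x y : R} :
  is_involution star -> is_inverse x y ->
  Defs.hermitian star x -> Defs.hermitian star y.
Proof.
move=> sI xy hx; have s1 := star1 sI; case: (sI) => _ sM _.
apply/esym/(is_inverse_uniq xy); case: xy => xy yx.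
by split; rewrite -{1}hx -sM ?xy ?yx s1.
Qed.

(** Since [h] is Hermitian, so is [star p * h * p]; hence [h * p] equals its own star,
    [star p * h]. *)
Lemma star_mul_fixed {R : pzRingType} {star : R -> R} {h p : R} :
  is_involution star -> Defs.hermitian star h ->
  star p * h * p = h * p -> star p * h = h * p.
Proof.
move=> [_ sM sK] hh e.
by have := congr1 star e; rewrite !sM hh sK mulrA e => ->.
Qed.

Lemma wMP_inverse_along {R : pzRingType} {star : R -> R} {a m n n_inv x : R} :
  is_involution star -> invertible m -> Defs.hermitian star m ->
  is_inverse n n_inv -> Defs.hermitian star n ->
  is_wMP star m n a x -> is_inverse_along a (n_inv * star a * m) x.
Proof.
move=> [_ sM _] [m' [mm' m'm]] hm [nn' n'n] hn [axa xax hl hr].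
have sxm : star x * star a * m = m * a * x by rewrite -[RHS]hl !sM hm !mulrA.
have san : star a * star x * n = n * x * a by rewrite -[RHS]hr !sM hn !mulrA.
have sa : star a * star x * star a = star a by rewrite -[in RHS]axa !sM mulrA.
have xa : n_inv * star a * star x * n = x * a.
  by rewrite -!mulrA [star a * _]mulrA san -!mulrA mulrA n'n mul1r.
have ax : m' * star x * star a * m = a * x.
  by rewrite -!mulrA [star x * _]mulrA sxm -!mulrA mulrA m'm mul1r.
(* Expand [x] as [(x * a) * x], resp. [x * (a * x)], substitute [xa], resp. [ax], and insert
   [m * m'], resp. [n * n_inv], to make the factor [d] appear. *)
have xd : x = n_inv * star a * m * (m' * star x * n * x).
  rewrite -[LHS]xax -xa -!mulrA; congr (_ * (_ * _)).
  by rewrite [RHS]mulrA mm' mul1r.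
have dx : x = x * m' * star x * n * (n_inv * star a * m).
  rewrite -[LHS]xax -[LHS]mulrA -ax -!mulrA; do 3 congr (_ * _).
  by rewrite [RHS]mulrA nn' mul1r.
(* Conversely, replace [star a] in [d] by [star a * star x * star a]; then [xa] or [sxm] brings out
   [x]. *)
have dr : n_inv * star a * m = x * (a * n_inv * star a * m).
  rewrite -[in LHS]sa !mulrA -xa -!mulrA; do 3 congr (_ * _).
  by rewrite [RHS]mulrA nn' mul1r.
have dl : n_inv * star a * m = n_inv * star a * m * a * x.
  by rewrite -[in LHS]sa -!mulrA [star x * _]mulrA sxm !mulrA.
split=> // z; split=> -[r ->].
- by exists (m' * star x * n * x * r); rewrite mulrA -xd.
- by exists (a * n_inv * star a * m * r); rewrite mulrA -dr.
- by exists (r * (x * m' * star x * n)); rewrite -mulrA -dx.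
- by exists (r * (n_inv * star a * m * a)); rewrite -[RHS]mulrA -dl.
Qed.

Lemma inverse_along_wMP {R : pzRingType} {star : R -> R} {a m n n_inv b : R} :
  is_involution star -> invertible m -> Defs.hermitian star m ->
  is_inverse n n_inv -> Defs.hermitian star n ->
  is_inverse_along a (n_inv * star a * m) b -> is_wMP star m n a b.
Proof.
move=> sI [m' [mm' m'm]] hm n_n' hn [bab bR Rb].
have hn' := hermitian_inverse sI n_n' hn.
case: (sI) => _ sM sK; case: n_n' => nn' n'n; set d := n_inv * star a * m.
have /bR [u du] : right_ideal d d by exists 1; rewrite mulr1.
have /Rb [v dv] : left_ideal d d by exists 1; rewrite mul1r.
have bad : b * a * d = d by rewrite du mulrA bab.
have dab : d * a * b = d by rewrite dv -!mulrA [b * (a * b)]mulrA bab.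
have amab : star a * m * a * b = star a * m.
  have := congr1 ( *%R n) dab.
  by rewrite /d !mulrA nn' mul1r.
have bana : b * a * n_inv * star a = n_inv * star a.
  have := congr1 ( *%R^~ m') bad.
  by rewrite /= /d -!mulrA mm' mulr1.
have pma : star (a * b) * m * a = m * a.
  by have := congr1 star amab; rewrite !sM sK hm !mulrA.
have hl : star (a * b) * m = m * (a * b).
  by apply: (star_mul_fixed sI hm); rewrite mulrA pma -mulrA.
(* Here [star_mul_fixed] is used with [h := n_inv] and [p := star (b * a)], the weight standing on
   the other side than in [hl]. *)
have hr : b * a * n_inv = n_inv * star (b * a).
  rewrite -[b * a in LHS]sK; apply: (star_mul_fixed sI hn').
  by rewrite sK [star _]sM !mulrA bana.
split=> //.
- by rewrite -[RHS]mul1r -m'm -[RHS]mulrA -pma hl !mulrA m'm mul1r.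
- by rewrite /Defs.hermitian -mulrA sM hm hl.
- rewrite /Defs.hermitian -mulrA sM hn.
  (* This is [hr] multiplied by [n] on both sides. *)
  by rewrite -[LHS]mul1r -nn' -mulrA [n_inv * _]mulrA -hr -!mulrA n'n mulr1.
Qed.

Theorem theorem3p2 (R : pzRingType) (star : R -> R)
    (star_inv : is_involution star)
    (a m n n_inv : R)
    (m_unit : invertible m) (m_pos : positive star m)
    (n_unit : is_inverse n n_inv) (n_pos : positive star n) :
  (wMP_invertible star m n a <-> invertible_along a (n_inv * star a * m)) /\
  (forall b x, is_inverse_along a (n_inv * star a * m) b ->
     is_wMP star m n a x -> b = x).
Proof.
have hm := positive_hermitian star_inv m_pos.
have hn := positive_hermitian star_inv n_pos.
split; first split.
- by move=> [x /(wMP_inverse_along star_inv m_unit hm n_unit hn)]; exists x.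
- by move=> [b /(inverse_along_wMP star_inv m_unit hm n_unit hn)]; exists b.
(* The forward direction shows that [x] itself is an inverse of [a] along [d], and such inverses are
   unique. *)
move=> b x ab /(wMP_inverse_along star_inv m_unit hm n_unit hn).
exact: is_inverse_along_uniq ab.
Qed.
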